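(* In the class of all graphs, finiteness is expressible in the modal language of graph theory: there is a sentence $\phi\in\mathcal{L}_\sim^{\Diamond}$ such that for every graph $G$, $$G\models\phi\quad\text{if and only if}\quad G\text{ is finite}.$$
   Context: A graph is a set of vertices (of any cardinality) together with an irreflexive symmetric binary edge relation $\sim$. $\mathcal{L}_\sim$ is the first-order language (with equality) whose only non-logical symbol is the binary relation symbol $\sim$. $\mathcal{L}_\sim^{\Diamond}$ is the full first-order modal language, closing $\mathcal{L}_\sim$ under the modal operators $\Diamond,\Box$, Boolean connectives and quantifiers. Formulas are evaluated at graphs, within the class of all graphs under the substructure relation: $G\models\Diamond\varphi[\bar a]$ iff there is a graph $H$ containing $G$ as a substructure (i.e. $G$ is an induced subgraph of $H$) with $H\models\varphi[\bar a]$; $G\models\Box\varphi[\bar a]$ iff $H\models\varphi[\bar a]$ for every graph $H$ containing $G$ as a substructure; Boolean connectives and quantifiers are interpreted as usual, with quantifiers ranging over the vertices of the graph at which the formula is evaluated. *)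

(* Defs.v *)
From Stdlib Require Import RelationClasses FinFun.

Set Implicit Arguments.
Unset Strict Implicit.

(* The vertex type may be empty. *)
Record graph : Type := Graph {
  vertex :> Type;
  adj : vertex -> vertex -> Prop;
  adj_irrefl : Irreflexive adj;
  adj_sym : Symmetric adj
}.

(* "H contains G as a substructure" is rendered by an embedding of G onto an
   induced subgraph of H: types have no literal inclusion, and transporting H
   along the embedding makes G a literal substructure of a copy of H. *)
Definition embedding (G H : graph) (f : G -> H) : Prop :=
  Injective f /\ forall x y : G, adj x y <-> adj (f x) (f y).

(* Formulas with free variables in X; a quantifier binds the variable None and
   shifts a free variable x to Some x. *)
Inductive formula (X : Set) : Set :=
| f_eq (x y : X)
| f_adj (x y : X)
| f_not (p : formula X)
| f_and (p q : formula X)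
| f_or (p q : formula X)
| f_imp (p q : formula X)
| f_ex (p : formula (option X))
| f_all (p : formula (option X))
| f_dia (p : formula X)
| f_box (p : formula X).

Definition sentence : Set := formula Empty_set.

Definition extend (X : Set) (V : Type) (a : X -> V) (v : V) : option X -> V :=
  fun x => match x with Some y => a y | None => v end.

Fixpoint sat (X : Set) (G : graph) (p : formula X) (a : X -> G) : Prop :=
  match p with
  | f_eq x y => a x = a y
  | f_adj x y => adj (a x) (a y)
  | f_not p => ~ sat p a
  | f_and p q => sat p a /\ sat q a
  | f_or p q => sat p a \/ sat q a
  | f_imp p q => sat p a -> sat q a
  | f_ex p => exists v : G, sat p (extend a v)
  | f_all p => forall v : G, sat p (extend a v)
  | f_dia p =>
      exists (H : graph) (f : G -> H), embedding f /\ sat p (fun x => f (a x))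
  | f_box p =>
      forall (H : graph) (f : G -> H), embedding f -> sat p (fun x => f (a x))
  end.

Definition models (G : graph) (p : sentence) : Prop :=
  sat p (fun x : Empty_set => match x return G with end).

(* Main.v *)
(* Every extension H of G contains all of G, so it is enough to say that some
   extension of G is finite, and H may be chosen to carry a certificate of its
   finiteness.  The certificate is a directed chain: three marker vertices
   colour the chain vertices cyclically, an edge is directed from each colour
   to the next, and every vertex of H is a marker, a chain vertex, or attached
   to a chain vertex to which no other such vertex is attached.

   The chain is finite as soon as its last vertex is reachable from its first
   one.  Reachability is expressible because every subset of H is the
   neighbourhood in H of a vertex of some extension of H, and because directed
   edges are defined without quantifiers, hence persist in extensions. *)

Require Import Defs.
From Stdlib Require Import FinFun.
From Stdlib Require Import List Lia Relations.
From Stdlib Require Import Classical_Prop Peano_dec.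

Import ListNotations.

Set Implicit Arguments.
Unset Strict Implicit.

(** * Coloured directed chains and finiteness certificates *)

Inductive color : Set := red | green | blue.

Definition next (k : color) : color :=
  match k with red => green | green => blue | blue => red end.

Fixpoint color_of (i : nat) : color :=
  match i with 0 => red | S i => next (color_of i) end.

Section Semantics.

Variables (G : graph) (m : color -> G).

Definition step (x y : G) : Prop :=
  adj x y /\ exists k, adj (m k) x /\ adj (m (next k)) y.

Definition reach : G -> G -> Prop := clos_refl_trans G step.

Definition special (a x : G) : Prop := (exists k, x = m k) \/ reach a x.

Definition attached (a c x : G) : Prop :=
  reach a c /\ adj c x /\ forall y, adj c y -> y = x \/ special a y.

(** Determinism of [step] and a reachable dead end [b] force the vertices reachable from [a] to form
    a finite path. *)
Definition certificate (a b : G) : Prop :=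
  (forall x y z, step x y -> step x z -> y = z) /\
  reach a b /\
  (forall y, ~ step b y) /\
  (forall x, special a x \/ exists c, attached a c x).

End Semantics.

(** * The certificate as a modal formula *)

Section Formulas.

Variable X : Set.

Definition f_some_color (F : color -> formula X) : formula X :=
  f_or (F red) (f_or (F green) (F blue)).

Definition f_step (m : color -> X) (x y : X) : formula X :=
  f_and (f_adj x y)
    (f_some_color (fun k => f_and (f_adj (m k) x) (f_adj (m (next k)) y))).

End Formulas.

Definition f_near (X : Set) (x y : X) : formula X := f_or (f_eq x y) (f_adj x y).

(* The vertex bound first codes the set of vertices equal or adjacent to it.
   Closed neighbourhoods are used because a step may lead to the coding vertex
   itself, if that vertex is adjacent to a marker; an open neighbourhood would
   then never be closed under steps. *)
Definition f_reach (X : Set) (m : color -> X) (a x : X) : formula X :=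
  f_box (f_all (f_imp
    (f_and (f_near None (Some a))
      (f_all (f_all (f_imp
        (f_and (f_near (Some (Some None)) (Some None))
          (f_step (fun k => Some (Some (Some (m k)))) (Some None) None))
        (f_near (Some (Some None)) None)))))
    (f_near None (Some x)))).

Definition f_special (X : Set) (m : color -> X) (a x : X) : formula X :=
  f_or (f_some_color (fun k => f_eq x (m k))) (f_reach m a x).

Definition f_attached (X : Set) (m : color -> X) (a c x : X) : formula X :=
  f_and (f_reach m a c) (f_and (f_adj c x)
    (f_all (f_imp (f_adj (Some c) None)
      (f_or (f_eq None (Some x))
        (f_special (fun k => Some (m k)) (Some a) None))))).

Definition f_certificate (X : Set) (m : color -> X) (a b : X) : formula X :=
  f_and
    (f_all (f_all (f_all
      (let m' := fun k => Some (Some (Some (m k))) in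
       f_imp (f_step m' (Some (Some None)) (Some None))
        (f_imp (f_step m' (Some (Some None)) None)
          (f_eq (Some None) None))))))
  (f_and (f_reach m a b)
  (f_and (f_all (f_not (f_step (fun k => Some (m k)) (Some b) None)))
    (f_all (f_or (f_special (fun k => Some (m k)) (Some a) None)
      (f_ex (f_attached (fun k => Some (Some (m k))) (Some (Some a))
        None (Some None))))))).

(** * Agreement of the formulas with their intended meaning *)

Lemma sat_some_color (X : Set) (G : graph) (F : color -> formula X)
    (e : X -> G) :
  sat (f_some_color F) e <-> exists k, sat (F k) e.
Proof.
  cbn; split.
  - intros [h | [h | h]]; eexists; exact h.
  - intros [[ | | ] h]; auto.
Qed.

Lemma sat_step (X : Set) (G : graph) (m : color -> X) (x y : X) (e : X -> G) :
  sat (f_step m x y) e <-> step (fun k => e (m k)) (e x) (e y).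
Proof.
  unfold f_step, step; cbn [sat]; rewrite sat_some_color; reflexivity.
Qed.

Lemma step_embedding (G H : graph) (f : G -> H) (m : color -> G) (x y : G) :
  embedding f -> step m x y -> step (fun k => f (m k)) (f x) (f y).
Proof.
  intros [_ hf] [hxy [k [hx hy]]].
  split; [apply hf, hxy | exists k; split; apply hf; assumption].
Qed.

Definition add_vertex_adj (G : graph) (A : G -> Prop) (x y : option G) : Prop :=
  match x, y with
  | Some x, Some y => adj x y
  | None, Some x | Some x, None => A x
  | None, None => False
  end.

Definition add_vertex (G : graph) (A : G -> Prop) : graph.
Proof.
  refine (@Graph (option G) (@add_vertex_adj G A) _ _).
  - intros [x | ]; [apply (adj_irrefl (x := x)) | intros []].
  - intros [x | ] [y | ]; cbn; auto; apply adj_sym.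
Defined.

Lemma add_vertex_embedding (G : graph) (A : G -> Prop) :
  embedding (H := add_vertex A) (@Some G).
Proof.
  split; [intros x y; congruence | reflexivity].
Qed.

Lemma sat_reach (X : Set) (G : graph) (m : color -> X) (a x : X) (e : X -> G) :
  sat (f_reach m a x) e <-> reach (fun k => e (m k)) (e a) (e x).
Proof.
  unfold f_reach, f_near; cbn [sat]; split.
  - intros h.
    (* The box is tested on one extension only: [G] plus a vertex adjacent to exactly the reachable
       vertices. *)
    set (A := reach (fun k => e (m k)) (e a)).
    specialize (h (add_vertex A) _ (add_vertex_embedding A) None).
    cut (A (e x)); [trivial | ].
    assert (hv : None = Some (e x) \/ A (e x)); [ | now destruct hv].
    apply h; clear h; split; [right; apply rt_refl | ].
    intros y [z | ] [hy hs]; [right | now left].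
    rewrite sat_step in hs.
    destruct y as [y | ]; cbn in hy.
    + destruct hy as [hy | hy]; [discriminate | ].
      eapply rt_trans; [exact hy | apply rt_step, hs].
    (* A step out of the coding vertex ends at one of its neighbours, and these are the elements of
       [A]. *)
    + apply hs.
  - intros h H f hf v [ha hs].
    apply clos_rt_rtn1 in h; cbn in ha |- *.
    induction h as [ | y z hyz _ IH]; [exact ha | ].
    apply (hs (f y)); split; [exact IH | ].
    rewrite sat_step; exact (step_embedding hf hyz).
Qed.

Lemma sat_special (X : Set) (G : graph) (m : color -> X) (a x : X) (e : X -> G) :
  sat (f_special m a x) e <-> special (fun k => e (m k)) (e a) (e x).
Proof.
  unfold f_special, special; cbn [sat].
  rewrite sat_some_color, sat_reach; reflexivity.
Qed.

Lemma sat_attached (X : Set) (G : graph) (m : color -> X) (a c x : X)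
    (e : X -> G) :
  sat (f_attached m a c x) e <->
  attached (fun k => e (m k)) (e a) (e c) (e x).
Proof.
  unfold f_attached, attached; cbn [sat].
  rewrite sat_reach; setoid_rewrite sat_special; reflexivity.
Qed.

Lemma sat_certificate (X : Set) (G : graph) (m : color -> X) (a b : X)
    (e : X -> G) :
  sat (f_certificate m a b) e <->
  certificate (fun k => e (m k)) (e a) (e b).
Proof.
  unfold f_certificate, certificate; cbn [sat].
  rewrite sat_reach; setoid_rewrite sat_step.
  setoid_rewrite sat_special; setoid_rewrite sat_attached; reflexivity.
Qed.

(** * Finiteness of graphs that carry a certificate *)

Lemma finite_preimages (A B : Type) (R : A -> B -> Prop) (l : list A) :
  (forall x y y', R x y -> R x y' -> y = y') ->
  exists l', forall x y, In x l -> R x y -> In y l'.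
Proof.
  intros hR; induction l as [ | x l [l' IH]]; [now exists [] | ].
  (* [R] may be undefined at [x]; excluded middle decides whether there is a value to add. *)
  destruct (classic (exists y, R x y)) as [[y hy] | hx].
  - exists (y :: l'); intros x' y' [<- | hx'] h.
    + left; exact (hR _ _ _ hy h).
    + right; exact (IH _ _ hx' h).
  - exists l'; intros x' y' [<- | hx'] h.
    + destruct hx; exists y'; exact h.
    + exact (IH _ _ hx' h).
Qed.

Lemma finite_injective (A B : Type) (f : A -> B) :
  Injective f -> Finite B -> Finite A.
Proof.
  intros hf [l hl].
  destruct (@finite_preimages B A (fun y x => f x = y) l) as [l' hl'].
  - intros y x x' h h'; apply hf; congruence.
  - exists l'; intros x; exact (hl' _ _ (hl (f x)) eq_refl).
Qed.

(** By determinism, whatever is reachable from [a] is [a] itself or reachable from its only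
    successor, so induction along the path to [b] lists everything. *)
Lemma finite_reachable (A : Type) (R : A -> A -> Prop) (a b : A) :
  (forall x y z, R x y -> R x z -> y = z) ->
  clos_refl_trans A R a b -> (forall y, ~ R b y) ->
  exists l, forall x, clos_refl_trans A R a x -> In x l.
Proof.
  intros hR hab hb; apply clos_rt_rt1n in hab.
  induction hab as [b | a a' b haa' _ IH].
  - exists [b]; intros x h; apply clos_rt_rt1n in h.
    destruct h as [ | y z h _]; [now left | destruct (hb _ h)].
  - destruct (IH hb) as [l hl]; exists (a :: l).
    intros x h; apply clos_rt_rt1n in h.
    destruct h as [ | y z h hyz]; [now left | right].
    apply hl; rewrite (hR _ _ _ haa' h); apply clos_rt1n_rt, hyz.
Qed.

Lemma certificate_finite (G : graph) (m : color -> G) (a b : G) :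
  certificate m a b -> Finite G.
Proof.
  intros (hfun & hab & hb & hcover).
  destruct (finite_reachable hfun hab hb) as [l hl].
  destruct (@finite_preimages G G
    (fun c x => ~ special m a x /\ attached m a c x) l) as [l' hl'].
  - intros c x x' [hx (_ & _ & h)] [hx' (_ & hcx' & _)].
    destruct (h x' hcx') as [-> | ]; [reflexivity | contradiction].
  - exists (map m [red; green; blue] ++ l ++ l'); intros x.
    rewrite !in_app_iff.
    destruct (classic (special m a x)) as [[[k ->] | hx] | hx].
    + left; apply in_map; destruct k; cbn; auto.
    + right; left; apply hl, hx.
    + right; right.
      destruct (hcover x) as [ | [c hc]]; [contradiction | ].
      apply (hl' c); [apply hl, hc | split; assumption].
Qed.

(** * A certified extension of a finite graph *)

Section CertifiedExtension.

Variables (G : graph) (l : list G).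

(** The chain has one vertex more than [l] has entries, so it is nonempty even for the empty graph;
    nothing old is attached to its last vertex. *)
Inductive certified_vertex : Type :=
| old (x : G)
| chain (i : nat) (hi : i <= length l)
| marker (k : color).

Definition certified_adj (u v : certified_vertex) : Prop :=
  match u, v with
  | old x, old y => adj x y
  | old x, @chain i _ | @chain i _, old x => nth_error l i = Some x
  | @chain i _, @chain j _ => j = S i \/ i = S j
  | @chain i _, marker k | marker k, @chain i _ => color_of i = k
  | _, _ => False
  end.

Definition certified_extension : graph.
Proof.
  refine (@Graph certified_vertex certified_adj _ _).
  - intros [x | i hi | k] h; cbn in h; [exact (adj_irrefl h) | lia | exact h].
  - intros [x | i hi | k] [y | j hj | k']; cbn; auto; [apply adj_sym | lia].
Defined.

Lemma certified_embedding : embedding (H := certified_extension) old.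
Proof.
  split; [intros x y h; now injection h | reflexivity].
Qed.

(** This is why there are three colours: with two, a chain edge would be a step in both
    directions. *)
Lemma next_next (k : color) : next (next k) <> k.
Proof.
  destruct k; discriminate.
Qed.

Variable m : color -> certified_extension.
(** Assumed pointwise because the valuation in [f_finite] yields [m] as a case distinction on the
    colour. *)
Hypothesis hm : forall k, m k = marker k.

Lemma certified_step (u v : certified_extension) :
  step m u v <->
  exists i hi hi', u = @chain i hi /\ v = @chain (S i) hi'.
Proof.
  unfold step; setoid_rewrite hm; split.
  - destruct u as [x | i hi | k], v as [y | j hj | k'];
      intros [huv [k0 [hu hv]]]; cbn in *; try contradiction.
    destruct huv as [-> | ->]; [now exists i, hi, hj | ].
    destruct (@next_next (color_of j)); cbn in hu; congruence.
  - intros (i & hi & hi' & -> & ->); cbn; eauto.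
Qed.

Lemma certified_reach (i : nat) (hi : i <= length l) :
  reach m (chain (le_0_n _)) (chain hi).
Proof.
  induction i as [ | i IH].
  (* Chain vertices carry a proof of their bound; uniqueness of such proofs identifies vertices of
     equal index. *)
  - rewrite (le_unique _ _ hi (le_0_n _)); apply rt_refl.
  - assert (hi' : i <= length l) by lia.
    apply rt_trans with (chain hi'); [apply IH | apply rt_step].
    apply certified_step; now exists i, hi', hi.
Qed.

Lemma certified_certificate :
  Full l -> certificate m (chain (le_0_n _)) (chain (le_n _)).
Proof.
  intros hl; split; [ | split; [ | split]].
  - intros x y z hy hz; apply certified_step in hy, hz.
    destruct hy as (i & hi & hSi & -> & ->), hz as (j & hj & hSj & hij & ->).
    injection hij as <-; now rewrite (le_unique _ _ hSi hSj).
  - apply certified_reach.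
  - intros y hy; apply certified_step in hy.
    destruct hy as (i & hi & hSi & h & _); injection h; lia.
  - intros [x | i hi | k].
    + right.
      destruct (In_nth_error _ _ (hl x)) as [i hx].
      assert (hi : i <= length l).
      { apply PeanoNat.Nat.lt_le_incl, nth_error_Some; congruence. }
      exists (chain hi); split; [apply certified_reach | split; [exact hx | ]].
      intros [y | j hj | k] hy; cbn in hy.
      * left; congruence.
      * right; right; apply certified_reach.
      * right; left; exists k; now rewrite hm.
    + left; right; apply certified_reach.
    + left; left; exists k; now rewrite hm.
Qed.

End CertifiedExtension.

(** From the outside in, the quantifiers bind the end of the chain, its start, and the blue, green
    and red markers. *)
Definition f_finite : sentence :=
  f_dia (f_ex (f_ex (f_ex (f_ex (f_ex
    (f_certificate
      (fun k => match k with
                | red => None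
                | green => Some None
                | blue => Some (Some None)
                end)
      (Some (Some (Some None))) (Some (Some (Some (Some None)))))))))).

Theorem theorem3 :
  exists phi : sentence, forall G : graph, models G phi <-> Finite G.
Proof.
  exists f_finite; intros G; unfold models, f_finite; cbn [sat].
  setoid_rewrite sat_certificate; split.
  - intros (H & f & [hf _] & b & a & p & q & r & h).
    exact (finite_injective hf (certificate_finite h)).
  - intros [l hl].
    exists (certified_extension l), (@old G l).
    split; [apply certified_embedding | ].
    exists (chain (le_n _)), (chain (le_0_n _)).
    exists (marker l blue), (marker l green), (marker l red).
    apply certified_certificate; [intros []; reflexivity | exact hl].
Qed.
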